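(* For all integers $\alpha \geq 0$ and $n \geq 0$, and for each $i \in \{1,2,3,4\}$, $$\mathrm{RD}^{(4,9)}\left(6 \cdot 5^{2\alpha+2}n + 6 \cdot 5^{2\alpha+1}i + 5^{2\alpha+2} + 1\right) \equiv 0 \pmod{6}.$$
   Context: For a nonnegative integer $n$, $\mathrm{RD}^{(4,9)}(n)$ denotes the number of partitions of $n$ into parts that are simultaneously 4-regular and 9-distinct, i.e., partitions of $n$ in which no part is divisible by $4$ and each distinct part appears at least once and at most $8$ times. Equivalently, writing $f_k = \prod_{m\ge1}(1-q^{km})$, $\sum_{n\ge0}\mathrm{RD}^{(4,9)}(n)q^n = \frac{f_9 f_4}{f_1 f_{36}}$. *)

(* Defs.v *)
From mathcomp Require Import all_boot.

Set Implicit Arguments.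
Unset Strict Implicit.
Unset Printing Implicit Defensive.

Definition is_partition (n : nat) (s : seq nat) : bool :=
  [&& sorted geq s, 0 \notin s & sumn s == n].

Definition regular (l : nat) (s : seq nat) : bool :=
  all (fun k => ~~ (l %| k)) s.

(* "t-distinct" in the sense that every part is repeated fewer than t times
   (not that there are t different parts). *)
Definition distinct (t : nat) (s : seq nat) : bool :=
  all (fun k => count_mem k s < t) s.

(* A partition of n has at most n parts, each of them at most n, so every
   partition of n occurs exactly once in the finite type n.-bseq 'I_n.+1. *)
Definition RD (l t n : nat) : nat :=
  #|[set s : n.-bseq 'I_n.+1 |
      let p := [seq val k | k <- s] in
      [&& is_partition n p, regular l p & distinct t p]]|.

(* Main.v *)
Require Import Defs.
From mathcomp Require Import all_boot all_algebra.
From mathcomp Require Import ring zify.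

(* Write f_k for the product of the 1 - q^(km), psi(q) for the sum of the
   q^(k(k+1)/2) over k >= 0 and phi(q) for the sum of the (-1)^k q^(k^2) over
   all integers k. Shanks' finite identities give Gauss' formulas
   f_1 psi(q) = f_2^2 and f_2 phi(q) = f_1^2; hence P := f_1 / f_4 satisfies
   P(q)^2 psi(q^2) = phi(q), and P(q) psi(q) = 1 mod 2. Let F be the generating
   function of RD 4 9 and N := 6m + 2 the argument in the theorem.
   Mod 2: F(q) = P(q^9) / P(q), so F(q) psi(q^9) = psi(q); triangular numbers
   are never 2 mod 3, so neither are the exponents occurring in F mod 2.
   Mod 3: F = P^8, so F(q) psi(q^2)^4 = phi(q)^4, that is,
   F(q) psi(q^2) psi(q^6) = phi(q) phi(q^3). The part of the
   right-hand side of even degree counts the solutions of x^2 + 3 y^2 = n with n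
   even; the rotation of order 3 of the hexagonal lattice makes it congruent to
   1. So the even part E(q^2) of F satisfies E(q) psi(q^3)^2 = psi(q)^2. From
   psi(q) = A(q^3) + q psi(q^9) one gets the sum of the RD 4 9 (6m+2) q^m to be
   2 A psi mod 3. The exponents m of A psi satisfy 24 m + 4 = x^2 + 3 y^2, which
   is impossible when the 5-adic valuation of N - 1 = 6m + 1 is odd, because -3
   is not a square mod 5. All power series are truncated modulo q^L. *)

Set Implicit Arguments.
Unset Strict Implicit.
Unset Printing Implicit Defensive.

Import GRing.Theory.
Local Open Scope ring_scope.

(** * Truncated theta series and Shanks' finite identities *)

Definition psi (R : pzRingType) (K : nat) (q : R) : R :=
  \sum_(0 <= k < K) q ^+ 'C(k.+1, 2).

Definition phi (R : pzRingType) (K : nat) (q : R) : R :=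
  1 + 2 * \sum_(1 <= k < K.+1) (-1) ^+ k * q ^+ (k ^ 2).

Lemma bin2_double n : 'C(n.*2.+1, 2) = (n * n.*2.+1)%N.
Proof. by rewrite bin2 /=; nia. Qed.

Lemma bin2_doubleS n : 'C(n.*2.+2, 2) = (n.*2.+1 * n.+1)%N.
Proof. by rewrite bin2 /=; nia. Qed.

Lemma psi_shanks (R : comPzRingType) (q : R) n :
  psi n.*2 q * \prod_(0 <= k < n) (1 - q ^+ k.*2.+1) =
  \sum_(0 <= s < n) q ^+ (s * n.*2.+1) *
     \prod_(s <= k < n) (1 - q ^+ k.*2.+2) * \prod_(0 <= k < s) (1 - q ^+ k.*2.+1).
Proof.
rewrite /psi; elim: n => [|n IHn]; first by rewrite !big_geq // mul0r.
pose u s := q ^+ (s * n.*2.+1) * \prod_(s <= k < n) (1 - q ^+ k.*2.+2) *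
              \prod_(0 <= k < s) (1 - q ^+ k.*2.+1).
(* From n to n + 1 the left side gains the factor 1 - q^(2n+1) and two new terms of [psi], while
   each [u s] gains the factor q^(2s) (1 - q^(2n+2)). The difference of these factors, times [u s],
   is v (s + 1) - v s with v s = u s (1 - q^(2s)) and v 0 = 0. *)
have tele m : (m <= n)%N ->
  \sum_(0 <= s < m) u s * (q ^+ s.*2 * (1 - q ^+ n.*2.+2) - (1 - q ^+ n.*2.+1)) =
  u m * (1 - q ^+ m.*2).
  elim: m => [|m IHm] lt_mn; first by rewrite big_geq // subrr mulr0.
  rewrite big_nat_recr //= IHm 1?ltnW // /u.
  rewrite (big_ltn lt_mn) [\prod_(0 <= k < m.+1) _]big_nat_recr //= doubleS mulSn exprD.
  by rewrite !exprS; ring.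
have {}tele := tele n (leqnn n).
have un : u n = q ^+ (n * n.*2.+1) * \prod_(0 <= k < n) (1 - q ^+ k.*2.+1).
  by rewrite /u big_geq // mulr1.
have -> : \sum_(0 <= s < n.+1) q ^+ (s * n.+1.*2.+1) *
     \prod_(s <= k < n.+1) (1 - q ^+ k.*2.+2) * \prod_(0 <= k < s) (1 - q ^+ k.*2.+1)
  = \sum_(0 <= s < n.+1) u s * (q ^+ s.*2 * (1 - q ^+ n.*2.+2)).
  apply: eq_big_nat => s /andP[_ le_sn]; rewrite /u big_nat_recr //=.
  have -> : (s * n.+1.*2.+1 = s * n.*2.+1 + s.*2)%N by nia.
  by rewrite exprD; ring.
have -> : \sum_(0 <= s < n.+1) u s * (q ^+ s.*2 * (1 - q ^+ n.*2.+2)) =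
  \sum_(0 <= s < n) u s * (q ^+ s.*2 * (1 - q ^+ n.*2.+2) - (1 - q ^+ n.*2.+1))
  + (\sum_(0 <= s < n) u s) * (1 - q ^+ n.*2.+1) + u n * (q ^+ n.*2 * (1 - q ^+ n.*2.+2)).
  by rewrite mulr_suml -big_split /= big_nat_recr //=; congr (_ + _); apply: eq_bigr => s _; ring.
rewrite tele -IHn doubleS !big_nat_recr //= un bin2_double bin2_doubleS.
have -> : (n.*2.+1 * n.+1 = n * n.*2.+1 + n.*2.+1)%N by nia.
by rewrite exprD !exprS; ring.
Qed.

Lemma phi_shanks (R : comPzRingType) (q : R) n :
  phi n q * \prod_(1 <= k < n.+1) (1 + q ^+ k) =
  \sum_(0 <= s < n.+1) (-1) ^+ s * q ^+ (s * n.+1) *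
     \prod_(s <= k < n) (1 - q ^+ k.+1) * \prod_(0 <= k < s) (1 + q ^+ k).
Proof.
rewrite /phi; elim: n => [|n IHn].
  by rewrite [RHS]big_nat1 !big_geq // mul0n !expr0; ring.
pose u s := (-1) ^+ s * q ^+ (s * n.+1) *
     \prod_(s <= k < n) (1 - q ^+ k.+1) * \prod_(0 <= k < s) (1 + q ^+ k).
(* Same telescoping, with the factors q^s (1 - q^(n+1)) and 1 + q^(n+1). *)
have tele m : (m <= n)%N ->
  \sum_(0 <= s < m) u s * (q ^+ s * (1 - q ^+ n.+1) - (1 + q ^+ n.+1)) =
  u m * (1 - q ^+ m).
  elim: m => [|m IHm] lt_mn; first by rewrite big_geq // subrr mulr0.
  rewrite big_nat_recr //= IHm 1?ltnW // /u.
  rewrite (big_ltn lt_mn) [\prod_(0 <= k < m.+1) _]big_nat_recr //= mulSn exprD.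
  by rewrite !exprS; ring.
have {}tele := tele n (leqnn n).
have un : u n = (-1) ^+ n * q ^+ (n * n.+1) * \prod_(0 <= k < n) (1 + q ^+ k).
  by rewrite /u big_geq // mulr1.
have -> : \sum_(0 <= s < n.+2) (-1) ^+ s * q ^+ (s * n.+2) *
     \prod_(s <= k < n.+1) (1 - q ^+ k.+1) * \prod_(0 <= k < s) (1 + q ^+ k)
  = \sum_(0 <= s < n.+1) u s * (q ^+ s * (1 - q ^+ n.+1))
    - (-1) ^+ n * q ^+ (n.+1 * n.+2) * \prod_(0 <= k < n.+1) (1 + q ^+ k).
  rewrite big_nat_recr //= [\prod_(n.+1 <= k < n.+1) _]big_geq // exprS.
  congr (_ + _); last by ring.
  apply: eq_big_nat => s /andP[_ le_sn]; rewrite /u big_nat_recr //=.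
  have -> : (s * n.+2 = s * n.+1 + s)%N by nia.
  by rewrite exprD; ring.
have -> : \sum_(0 <= s < n.+1) u s * (q ^+ s * (1 - q ^+ n.+1)) =
  \sum_(0 <= s < n) u s * (q ^+ s * (1 - q ^+ n.+1) - (1 + q ^+ n.+1))
  + (\sum_(0 <= s < n.+1) u s) * (1 + q ^+ n.+1)
  + u n * (q ^+ n * (1 - q ^+ n.+1) - (1 + q ^+ n.+1)).
  rewrite [\sum_(0 <= s < n.+1) u s]big_nat_recr //= mulrDl mulr_suml addrA -big_split /=.
  rewrite big_nat_recr //= -addrA -mulrDr; congr (_ + u n * _); last by ring.
  by apply: eq_bigr => s _; ring.
rewrite tele -IHn [\sum_(1 <= k < n.+2) _]big_nat_recr //=.
rewrite [\prod_(1 <= k < n.+2) _]big_nat_recr //= un.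
(* The factor at k = 0 is 2; it accounts for the coefficient 2 of the new term of [phi]. *)
have prod_u : \prod_(0 <= k < n) (1 + q ^+ k) * (1 + q ^+ n) =
    2 * \prod_(1 <= k < n.+1) (1 + q ^+ k).
  by rewrite -big_nat_recr //= big_ltn // expr0.
rewrite [\prod_(0 <= k < n.+1) _]big_nat_recr //= prod_u.
have -> : (n.+1 * n.+2 = n * n.+1 + n.+1 + n.+1)%N by nia.
have -> : (n.+1 ^ 2 = n * n.+1 + n.+1)%N by nia.
move: prod_u; set V := \prod_(0 <= k < n) _; set W := \prod_(1 <= k < n.+1) _ => VW.
apply: subr0_eq.
transitivity ((-1) ^+ n * q ^+ (n * n.+1) * q ^+ n.+1 * (V * (1 + q ^+ n) - 2 * W));
  last by rewrite VW subrr mulr0.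
by rewrite [(-1) ^+ n.+1]exprS !exprD; ring.
Qed.

(** * Finite Euler products and Gauss' formulas with an error term *)

Definition euler (R : pzRingType) (N : nat) (q : R) : R :=
  \prod_(1 <= k < N.+1) (1 - q ^+ k).

(** The quotient f_1 / f_4, as a product over the non-multiples of 4 so that no division occurs. *)
Definition euler4 (R : pzRingType) (N : nat) (q : R) : R :=
  \prod_(1 <= k < N.+1 | ~~ (4 %| k)%N) (1 - q ^+ k).

Lemma euler_sqr (R : comPzRingType) (q : R) N :
  euler N (q ^+ 2) = euler N q * \prod_(1 <= k < N.+1) (1 + q ^+ k).
Proof.
rewrite /euler -big_split /=; apply: eq_bigr => k _.
by rewrite -exprM mulnC exprM; ring.
Qed.

Lemma euler_double (R : comPzRingType) (q : R) n :
  euler n.*2 q = \prod_(0 <= k < n) (1 - q ^+ k.*2.+1) * euler n (q ^+ 2).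
Proof.
elim: n => [|n IHn]; first by rewrite /euler !big_geq ?mulr1.
rewrite /euler in IHn *; rewrite doubleS; do 2![rewrite [in LHS]big_nat_recr //=].
rewrite IHn; do 2![rewrite [in RHS]big_nat_recr //=].
by rewrite -exprM mul2n doubleS; ring.
Qed.

Lemma euler4E (R : comPzRingType) (q : R) M :
  euler4 (4 * M) q * euler M (q ^+ 4) = euler (4 * M) q.
Proof.
rewrite /euler4 /euler big_mkcond /=; elim: M => [|M IHM]; first by rewrite !big_geq ?mulr1.
have -> : (4 * M.+1 = (4 * M).+4)%N by lia.
do 4![rewrite [\prod_(1 <= k < _.+1) (if _ then _ else _)]big_nat_recr //=].
do 4![rewrite [\prod_(1 <= k < _.+1) (1 - q ^+ k)]big_nat_recr //=].
rewrite [\prod_(1 <= k < M.+1 .+1) _]big_nat_recr //= -IHM -exprM.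
have -> : (4 %| (4 * M).+1)%N = false by lia.
have -> : (4 %| (4 * M).+2)%N = false by lia.
have -> : (4 %| (4 * M).+3)%N = false by lia.
have -> : (4 %| (4 * M).+4)%N by lia.
have -> : (4 * M.+1 = (4 * M).+4)%N by lia.
by rewrite /=; ring.
Qed.

(** In Shanks' identity every term with s > 0 contains q^(2n+1). Multiplying by [euler n (q ^+ 2)]
    completes the odd factors to [euler n.*2 q] and squares the term s = 0. *)
Lemma psi_euler (R : comPzRingType) (q : R) n : (0 < n)%N ->
  exists r, psi n.*2 q * euler n.*2 q = euler n (q ^+ 2) ^+ 2 + q ^+ n.*2.+1 * r.
Proof.
move=> n_gt0.
exists (\sum_(1 <= s < n) q ^+ (s.-1 * n.*2.+1) *
     \prod_(s <= k < n) (1 - q ^+ k.*2.+2) * \prod_(0 <= k < s) (1 - q ^+ k.*2.+1)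
     * euler n (q ^+ 2)).
have eA : \prod_(0 <= k < n) (1 - q ^+ k.*2.+2) = euler n (q ^+ 2).
  by rewrite /euler big_add1 /=; apply: eq_bigr => k _; rewrite -exprM mul2n doubleS.
rewrite euler_double mulrA psi_shanks big_ltn // mul0n expr0 mul1r.
rewrite [\prod_(0 <= k < 0) _]big_geq // mulr1 eA mulrDl expr2; congr (_ + _).
rewrite mulr_sumr mulr_suml; apply: eq_big_nat => -[//|s] _ /=.
by rewrite mulSn exprD; ring.
Qed.

Lemma phi_euler (R : comPzRingType) (q : R) n :
  exists r, phi n q * euler n (q ^+ 2) = euler n q ^+ 2 + q ^+ n.+1 * r.
Proof.
exists (\sum_(1 <= s < n.+1) (-1) ^+ s * q ^+ (s.-1 * n.+1) *
     \prod_(s <= k < n) (1 - q ^+ k.+1) * \prod_(0 <= k < s) (1 + q ^+ k) * euler n q).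
rewrite euler_sqr [euler n q * _]mulrC mulrA phi_shanks big_ltn // mul0n !expr0 !mul1r.
rewrite [\prod_(0 <= k < 0) _]big_geq // mulr1 mulrDl expr2.
have eE : \prod_(0 <= k < n) (1 - q ^+ k.+1) = euler n q by rewrite /euler big_add1.
rewrite eE; congr (_ + _).
rewrite mulr_sumr mulr_suml; apply: eq_big_nat => -[//|s] _ /=.
by rewrite mulSn exprD; ring.
Qed.

(** * Frobenius on theta series and Euler products *)

Section Frobenius.
Variables (R : comNzRingType) (p : nat) (pcharRp : p \in [pchar R]) (q : R).

Lemma psi_pchar K : psi K q ^+ p = psi K (q ^+ p).
Proof.
rewrite -(pFrobenius_autE pcharRp) rmorph_sum /=; apply: eq_bigr => k _.
by rewrite rmorphXn.
Qed.

Lemma phi_pchar K : phi K q ^+ p = phi K (q ^+ p).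
Proof.
rewrite -(pFrobenius_autE pcharRp) /phi rmorphD rmorphM rmorph1 rmorph_nat rmorph_sum /=.
congr (_ + 2 * _); apply: eq_bigr => k _.
by rewrite rmorphM !rmorphXn rmorphN1.
Qed.

Lemma euler_pchar N : euler N q ^+ p = euler N (q ^+ p).
Proof.
rewrite -(pFrobenius_autE pcharRp) rmorph_prod /=; apply: eq_bigr => k _.
by rewrite rmorphB rmorph1 rmorphXn.
Qed.
End Frobenius.

(** * Power series modulo X^L, with Gauss' formulas in this form *)

Section EqMod.
Variable F : fieldType.
Implicit Types (c p q r : {poly F}) (L : nat).

Definition eqX L p q := 'X^L %| p - q.

Lemma eqX_refl L p : eqX L p p.
Proof. by rewrite /eqX subrr dvdp0. Qed.

Lemma eqX_sym L p q : eqX L p q -> eqX L q p.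
Proof. by rewrite /eqX -opprB dvdpNr. Qed.

Lemma eqX_trans L p q r : eqX L p q -> eqX L q r -> eqX L p r.
Proof. by move=> pq qr; rewrite /eqX -(subrKA q p) dvdp_add. Qed.

Lemma eqX_mul L p p' q q' : eqX L p p' -> eqX L q q' -> eqX L (p * q) (p' * q').
Proof.
move=> pp' qq'; rewrite /eqX.
have -> : p * q - p' * q' = (p - p') * q + p' * (q - q') by ring.
by rewrite dvdp_add ?(dvdp_mulr _ pp') ?(dvdp_mull _ qq').
Qed.

Lemma eqX_exp L p p' n : eqX L p p' -> eqX L (p ^+ n) (p' ^+ n).
Proof.
move=> pp'; elim: n => [|n IHn]; first exact: eqX_refl.
by rewrite !exprS eqX_mul.
Qed.

(** Replaces division by a power series: a nonzero constant term makes [c] coprime to X^L. *)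
Lemma eqX_cancel L c p q : c`_0 != 0 -> eqX L (c * p) (c * q) -> eqX L p q.
Proof.
move=> c0; rewrite /eqX -mulrBr Gauss_dvdpr // coprimep_expl //.
by rewrite coprimep_sym coprimepX /root horner_coef0.
Qed.

Lemma eqX_coef L p q i : eqX L p q -> (i < L)%N -> p`_i = q`_i.
Proof.
move=> /dvdpP[r /(congr1 (fun s : {poly F} => s`_i))] + lt_iL.
by rewrite coefB coefMXn lt_iL => /eqP; rewrite subr_eq0 => /eqP.
Qed.

Lemma coef_eqX L p q : (forall i, (i < L)%N -> p`_i = q`_i) -> eqX L p q.
Proof.
move=> eq_pq; rewrite /eqX -(poly_take_drop L (p - q)).
have -> : take_poly L (p - q) = 0.
  apply/polyP => i; rewrite coef_take_poly coef0; case: ifP => // /eq_pq pqi.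
  by rewrite coefB pqi subrr.
by rewrite add0r dvdp_mulIr.
Qed.

Lemma eqXDr L p r : 'X^L %| r -> eqX L (p + r) p.
Proof. by rewrite /eqX addrAC subrr add0r. Qed.

Lemma eqX_prod1 L m n (P : pred nat) (E : nat -> {poly F}) : 
  (forall k, (m <= k < n)%N -> P k -> eqX L (E k) 1) ->
  eqX L (\prod_(m <= k < n | P k) E k) 1.
Proof.
move=> E1; rewrite big_nat_cond.
elim/big_ind: _ => [|p q pP qP|k /andP[]]; [exact: eqX_refl | | exact: E1].
by rewrite -[1]mulr1 eqX_mul.
Qed.

Lemma dvdp_Xn_exp L q k : 'X %| q -> (L <= k)%N -> 'X^L %| q ^+ k.
Proof.
by move=> Xq le_Lk; rewrite (dvdp_trans (dvdp_exp2l _ le_Lk)) // dvdp_exp2r.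
Qed.

Lemma eqX_1B L q k : 'X %| q -> (L <= k)%N -> eqX L (1 - q ^+ k) 1.
Proof. by move=> Xq le_Lk; apply: eqXDr; rewrite dvdpNr dvdp_Xn_exp. Qed.

Lemma euler_trunc L N q : 'X %| q -> (L <= N)%N -> eqX L (euler N q) (euler L q).
Proof.
move=> Xq le_LN; rewrite /euler (@big_cat_nat _ _ _ L.+1) //=.
rewrite -[X in eqX _ _ X]mulr1 eqX_mul ?eqX_refl //.
by apply: eqX_prod1 => k /andP[lt_Lk _] _; apply: eqX_1B; rewrite // ltnW.
Qed.

Lemma euler4_trunc L N q : 'X %| q -> (L <= N)%N -> eqX L (euler4 N q) (euler4 L q).
Proof.
move=> Xq le_LN; rewrite /euler4 (@big_cat_nat _ _ _ L.+1) //=.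
rewrite -[X in eqX _ _ X]mulr1 eqX_mul ?eqX_refl //.
by apply: eqX_prod1 => k /andP[lt_Lk _] _; apply: eqX_1B; rewrite // ltnW.
Qed.

Lemma psi_trunc L N q : 'X %| q -> (L <= N)%N -> eqX L (psi N q) (psi L q).
Proof.
move=> Xq le_LN; rewrite /psi (@big_cat_nat _ _ _ L) //=; apply: eqXDr.
rewrite big_nat_cond; elim/big_ind: _ => [||k /andP[/andP[le_Lk _] _]]; first exact: dvdp0.
  exact: dvdp_add.
by apply: dvdp_Xn_exp => //; rewrite bin2 /=; nia.
Qed.

Lemma coef0_euler N q : 'X %| q -> (euler N q)`_0 = 1.
Proof.
move=> Xq; rewrite (@eqX_coef 1 _ 1) ?coef1 //.
by apply: eqX_prod1 => k /andP[k_gt0 _] _; apply: eqX_1B.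
Qed.

Lemma coef0_psi N q : 'X %| q -> (0 < N)%N -> (psi N q)`_0 = 1.
Proof.
move=> Xq N_gt0; rewrite (@eqX_coef 1 _ (psi 1 q)) ?psi_trunc //.
by rewrite /psi big_nat1 expr0 coef1.
Qed.

Lemma psi_eulerX L q : 'X %| q -> eqX L (psi L q * euler L q) (euler L (q ^+ 2) ^+ 2).
Proof.
case: L => [|L] Xq; first by rewrite /eqX expr0 dvd1p.
have [r def_r] := psi_euler q (ltn0Sn L).
have le_L2 : (L.+1 <= L.+1.*2)%N by lia.
apply: (@eqX_trans _ _ (psi L.+1.*2 q * euler L.+1.*2 q)).
  by apply/eqX_sym/eqX_mul; [apply: psi_trunc | apply: euler_trunc].
rewrite def_r; apply: eqXDr; apply: dvdp_mulr; apply: dvdp_Xn_exp => //; lia.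
Qed.

Lemma phi_eulerX L q : 'X %| q -> eqX L (phi L q * euler L (q ^+ 2)) (euler L q ^+ 2).
Proof.
move=> Xq; have [r ->] := phi_euler q L.
by apply: eqXDr; apply: dvdp_mulr; apply: dvdp_Xn_exp.
Qed.

Lemma euler4X L q : 'X %| q -> eqX L (euler4 L q * euler L (q ^+ 4)) (euler L q).
Proof.
move=> Xq; have le_L4 : (L <= 4 * L)%N by lia.
apply: eqX_trans (euler_trunc Xq le_L4); rewrite -euler4E.
by apply: eqX_mul; [exact/eqX_sym/euler4_trunc | exact: eqX_refl].
Qed.

End EqMod.

#[local] Hint Resolve eqX_refl : core.

(** Multiplied by f_4 the left side becomes f_1 psi = f_2^2, which is f_4 by Frobenius. *)
Lemma euler4_psi_pchar2 (F : fieldType) (pcharF : 2 \in [pchar F]) L (q : {poly F}) :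
  'X %| q -> eqX L (euler4 L q * psi L q) 1.
Proof.
move=> Xq; have Xq4 : 'X %| q ^+ 4 by rewrite exprS dvdp_mulr.
have pchar2 : 2 \in [pchar {poly F}] by rewrite pchar_poly.
apply: (@eqX_cancel _ _ (euler L (q ^+ 4))); first by rewrite coef0_euler // oner_neq0.
have -> : euler L (q ^+ 4) * (euler4 L q * psi L q) =
  psi L q * (euler4 L q * euler L (q ^+ 4)) by ring.
apply: eqX_trans (eqX_mul (eqX_refl _ _) (euler4X L Xq)) _.
apply: eqX_trans (psi_eulerX L Xq) _.
by rewrite mulr1 euler_pchar // -exprM.
Qed.

(** Multiplied by f_4^2 f_2, both sides become f_1^2 f_4^2, by Gauss' formulas for psi(q^2) and
    phi(q). *)
Lemma euler4_psi_phi (F : fieldType) L (q : {poly F}) : 'X %| q ->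
  eqX L (euler4 L q ^+ 2 * psi L (q ^+ 2)) (phi L q).
Proof.
move=> Xq; have Xq2 : 'X %| q ^+ 2 by rewrite exprS dvdp_mulr.
have Xq4 : 'X %| q ^+ 4 by rewrite exprS dvdp_mulr.
set P := euler4 L q; set f4 := euler L (q ^+ 4); set f2 := euler L (q ^+ 2).
have psi2 : eqX L (psi L (q ^+ 2) * f2) (f4 ^+ 2).
  by apply: eqX_trans (psi_eulerX L Xq2) _; rewrite -exprM.
apply: (@eqX_cancel _ _ (f4 ^+ 2 * f2)).
  by rewrite coef0M -horner_coef0 horner_exp horner_coef0 !coef0_euler // expr1n mulr1 oner_neq0.
have -> : f4 ^+ 2 * f2 * (P ^+ 2 * psi L (q ^+ 2)) =
  (P * f4) ^+ 2 * (psi L (q ^+ 2) * f2) by ring.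
apply: eqX_trans (eqX_mul (eqX_exp 2 (euler4X L Xq)) psi2) _.
apply: eqX_trans (eqX_mul (eqX_sym (phi_eulerX L Xq)) (eqX_refl _ _)) _.
by have -> : phi L q * f2 * f4 ^+ 2 = f4 ^+ 2 * f2 * phi L q by ring.
Qed.

(** * Partitions as multiplicity functions, and their generating function *)

Section Multiplicities.
Local Open Scope nat_scope.
Variables l t n : nat.

(** The value at k is the multiplicity of the part k. Since l divides 0, the value at 0 is forced to
    be 0. *)
Definition mults : {set {ffun 'I_n.+1 -> 'I_t.+1}} :=
  [set f : {ffun 'I_n.+1 -> 'I_t.+1} | [forall k : 'I_n.+1, (l %| k) ==> (f k == ord0)]
           & \sum_(k < n.+1) k * f k == n].

Lemma sumn_count m (s : seq 'I_m) : sumn [seq val k | k <- s] = \sum_(k < m) k * count_mem k s.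
Proof.
elim: s => [|i s IHs] /=; first by rewrite big1 // => k _; rewrite muln0.
rewrite IHs (bigD1 i) //= [in RHS](bigD1 i) //= eqxx mulnDr muln1 addnA; congr (_ + _).
by apply: eq_bigr => k /negbTE; rewrite eq_sym => ->.
Qed.

Lemma count_val m (s : seq 'I_m) k : count_mem (val k) [seq val i | i <- s] = count_mem k s.
Proof. by rewrite count_map; apply: eq_count => i /=; rewrite val_eqE. Qed.

(** A nonincreasing sequence is determined by its multiplicities; sorting f k copies of each k
    inverts the map. *)
Lemma RD_mults : RD l t.+1 n = #|mults|.
Proof.
(* [inord] returns the true count only up to t, which [distinct t.+1] guarantees. *)
pose g (s : n.-bseq 'I_n.+1) := [ffun k => inord (count_mem k s) : 'I_t.+1].
have gE (s : n.-bseq 'I_n.+1) k :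
    distinct t.+1 [seq val i | i <- s] -> g s k = count_mem k s :> nat.
  move=> dis; rewrite ffunE inordK //; have [ks|ks] := boolP (k \in s).
    by rewrite -count_val; apply: (allP dis); apply: map_f.
  by rewrite (count_memPn ks).
rewrite /RD -(@card_in_imset _ _ g); last first.
  move=> s s'; rewrite !inE => /and3P[/and3P[srt _ _] _ dis] /and3P[/and3P[srt' _ _] _ dis'] eq_g.
  apply/val_inj/(inj_map val_inj); apply: (sorted_eq _ _ srt srt').
  - by move=> a b c /=; lia.
  - by move=> a b /=; lia.
  - apply: perm_map; rewrite /perm_eq; apply/allP => k _ /=.
    by rewrite -!gE // eq_g.
apply: eq_card => f; apply/imsetP/idP => [[s +] ->|]; rewrite !inE.
  move=> /and3P[/and3P[_ _ /eqP sum_s] reg dis]; apply/andP; split.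
    apply/forallP => k; apply/implyP => lk; rewrite -val_eqE /= gE //.
    apply/eqP/count_memPn/negP => ks; have := allP reg (val k) (map_f _ ks); by rewrite lk.
  by rewrite -[X in _ == X]sum_s sumn_count; apply/eqP/eq_bigr => k _; rewrite gE.
move=> /andP[/forallP f0 /eqP f_sum].
pose s0 := flatten [seq nseq (f k) k | k <- index_enum 'I_n.+1].
have count_s0 k : count_mem k s0 = f k.
  rewrite count_flatten -map_comp sumnE big_map (bigD1 k) //= count_nseq /= eqxx mul1n.
  by rewrite big1 ?addn0 // => i /negbTE ik; rewrite count_nseq /= ik.
pose leq' (i j : 'I_n.+1) := (j <= i)%N.
(* Each part that occurs is positive, so there are at most as many parts as their sum. *)
have size_s0 : size (sort leq' s0) <= n.
  rewrite size_sort size_flatten sumnE !big_map -[leqRHS]f_sum.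
  apply: leq_sum => k _; rewrite size_nseq; case: (posnP k) => [k0|k_gt0]; last exact: leq_pmull.
  by have := f0 k; rewrite k0 dvdn0 => /eqP ->; rewrite muln0.
have count_s k : count_mem k (sort leq' s0) = f k by rewrite (permP (permEl (perm_sort _ _))).
have mem_s k : k \in sort leq' s0 -> f k != 0 :> nat.
  by rewrite -has_pred1 has_count count_s -lt0n.
have dis : distinct t.+1 [seq val i | i <- Bseq size_s0].
  by apply/allP => _ /mapP[k _ ->]; rewrite count_val count_s.
exists (Bseq size_s0); last by apply/ffunP => k; apply/val_inj; rewrite /= gE // count_s.
have reg : regular l [seq val i | i <- Bseq size_s0].
  apply/allP => _ /mapP[k /mem_s + ->]; apply: contraNN => lk.
  by have := f0 k; rewrite lk => /eqP ->.
rewrite !inE dis reg !andbT; apply/and3P; split.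
- by rewrite sorted_map; apply: sort_sorted => i j; apply: leq_total.
- by apply/negP => /(allP reg); rewrite dvdn0.
- by rewrite sumn_count -[X in _ == X]f_sum; apply/eqP; apply: eq_bigr => k _; rewrite /= count_s.
Qed.

End Multiplicities.

Lemma RD_coef (R : comNzRingType) l t n :
  (\prod_(1 <= k < n.+1 | ~~ (l %| k)%N) \sum_(j < t.+1) 'X^(k * j) : {poly R})`_n
  = (RD l t.+1 n)%:R.
Proof.
rewrite RD_mults -sum1_card.
(* Excluded parts, 0 among them, get a factor 1 through j = 0, so that the product over all of
   ['I_n.+1] expands into a sum over functions. *)
have -> : \prod_(1 <= k < n.+1 | ~~ (l %| k)%N) \sum_(j < t.+1) 'X^(k * j)
  = \prod_(k < n.+1) \sum_(j < t.+1 | (l %| k)%N ==> (j == ord0)) ('X^(k * j) : {poly R}).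
  rewrite -(big_mkord xpredT (fun k =>
    \sum_(j < t.+1 | (l %| k)%N ==> (j == ord0)) ('X^(k * j) : {poly R}))).
  rewrite [RHS]big_ltn // dvdn0 /= big_pred1_eq mul0n expr0 mul1r [LHS]big_mkcond /=.
  apply: eq_bigr => k _; case: ifP => [/negbTE -> //|/negbFE ->].
  by rewrite big_pred1_eq muln0.
rewrite bigA_distr_big_dep coef_sum natr_sum.
rewrite (bigID (fun f : {ffun 'I_n.+1 -> 'I_t.+1} => \sum_(k < n.+1) k * f k == n)%N) /=.
rewrite [X in _ + X]big1 ?addr0 => [|f /andP[_ /negbTE f_sum]].
  apply: eq_big => [f|f /andP[_ /eqP f_sum]].
    rewrite [in RHS]inE; congr andb.
  by rewrite -expr_sum f_sum coefXn eqxx.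
by rewrite -expr_sum coefXn eq_sym f_sum.
Qed.

(** * Extraction of exponents in a residue class; 3-dissection of psi *)

Section Dissection.
Variable R : comNzRingType.
Implicit Types p u : {poly R}.

(** For d > 0 the bound [size p] loses nothing, as d i + r >= i. *)
Definition sect d r p : {poly R} := \poly_(i < size p) p`_(d * i + r).

Lemma coef_sect d r p i : (0 < d)%N -> (sect d r p)`_i = p`_(d * i + r).
Proof.
move=> d_gt0; rewrite coef_poly; case: ltnP => // le_pi.
by rewrite nth_default //; apply: leq_trans le_pi _; nia.
Qed.

Lemma sectD d r p1 p2 : (0 < d)%N -> sect d r (p1 + p2) = sect d r p1 + sect d r p2.
Proof. by move=> d_gt0; apply/polyP => i; rewrite coefD !coef_sect // coefD. Qed.

(** Multiplication by a series in X^d preserves the residues of exponents modulo d. *)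
Lemma sectM d r p u : (r < d)%N -> sect d r (p * (u \Po 'X^d)) = sect d r p * u.
Proof.
move=> lt_rd; have d_gt0 : (0 < d)%N by lia.
elim/poly_ind: u => [|u c IHu].
  by rewrite comp_poly0 !mulr0; apply/polyP => i; rewrite coef_sect // !coef0.
rewrite comp_polyD comp_polyM comp_polyX comp_polyC !mulrDr !mulrA sectD // -{}IHu.
congr (_ + _); apply/polyP => i; last by rewrite coef_sect // !coefMC coef_sect.
rewrite coef_sect // coefMXn coefMX; case: i => [|i]; first by rewrite muln0 lt_rd.
rewrite ltnNge mulnS -addnA leq_addr /= coef_sect //; congr (_`_ _); lia.
Qed.

Lemma sect_Xn d r m : (r < d)%N -> (m < d)%N -> sect d r 'X^m = (m == r)%:R.
Proof.
move=> lt_rd lt_md; apply/polyP => i; rewrite coef_sect ?coefXn ?coefMn ?coef1; last by lia.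
rewrite -mulrnA mulnb; congr (_%:R); congr nat_of_bool.
apply/eqP/andP => [e|[/eqP i0 /eqP ->]]; last by rewrite i0 muln0.
have i0 : i = 0%N by nia.
by move: e; rewrite i0 muln0 add0n => ->; rewrite !eqxx.
Qed.

End Dissection.

(** The bound says that d (M - 1) + r, the last index read, is below L. *)
Lemma eqX_sect (F : fieldType) d r L M (p q : {poly F}) : (0 < d)%N -> (d * M + r < L + d)%N ->
  eqX L p q -> eqX M (sect d r p) (sect d r q).
Proof.
move=> d_gt0 leM pq; apply: coef_eqX => i lt_iM; rewrite !coef_sect //.
by apply: eqX_coef pq _; nia.
Qed.

Lemma psi_comp (R : comNzRingType) K a d : psi K ('X^(a * d)) = psi K 'X^a \Po 'X^d :> {poly R}.
Proof.
rewrite /psi raddf_sum /=; apply: eq_bigr => k _.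
by rewrite -!exprM comp_Xn_poly -exprM; congr (_ ^+ _); lia.
Qed.

Lemma bin2S_double k : (2 * 'C(k.+1, 2))%N = (k * k.+1)%N.
Proof. by rewrite bin2 /= mul2n even_halfK ?[(k.+1 * k)%N]mulnC // oddM /= andbN. Qed.

(* The exponents are the (x^2 - 1) / 24 for x = 6j + 1 and x = 6j + 5. *)
Definition pent (R : pzRingType) K (q : R) : R :=
  \sum_(0 <= j < K) (q ^+ (3 * 'C(j, 2) + 2 * j) + q ^+ (3 * 'C(j, 2) + 4 * j + 1)).

(** The triangular numbers of index 3j and 3j + 2 are multiples of 3; that of index 3j + 1 is 9 j (j
    + 1) / 2 + 1. *)
Lemma psi_dissect (R : comPzRingType) K (q : R) :
  psi (3 * K) q = pent K (q ^+ 3) + q * psi K (q ^+ 9).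
Proof.
rewrite /psi /pent; elim: K => [|K IHK]; first by rewrite !big_geq // mulr0 addr0.
have -> : (3 * K.+1 = (3 * K).+3)%N by lia.
do 2![rewrite [in RHS]big_nat_recr //=]; rewrite -!exprM.
do 3![rewrite [\sum_(0 <= k < _.+1) q ^+ 'C(k.+1, 2)]big_nat_recr //=]; rewrite IHK.
have TK := bin2S_double K; rewrite binS bin1 in TK.
have T1 := bin2S_double (3 * K); have T2 := bin2S_double (3 * K).+1.
have T3 := bin2S_double (3 * K).+2.
have -> : 'C((3 * K).+1, 2) = (3 * (3 * 'C(K, 2) + 2 * K))%N by nia.
have -> : 'C((3 * K).+2, 2) = (9 * 'C(K.+1, 2)).+1%N by rewrite [in RHS]binS bin1; nia.
have -> : 'C((3 * K).+3, 2) = (3 * (3 * 'C(K, 2) + 4 * K + 1))%N by nia.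
by rewrite (exprS q (9 * _)); ring.
Qed.

(** * The form x^2 + 3 y^2 at the prime 5 *)

Lemma dvd5_sqr_3sqr x y : (5 %| x ^ 2 + 3 * y ^ 2)%N -> (5 %| x)%N && (5 %| y)%N.
Proof.
rewrite /dvdn -modnDm -modnXm -(modnMmr 3) -[(y ^ 2 %% 5)%N]modnXm modnMmr modnDm.
have := ltn_pmod x (isT : 0 < 5)%N; have := ltn_pmod y (isT : 0 < 5)%N.
by case: (x %% 5)%N => [|[|[|[|[|]]]]] //; case: (y %% 5)%N => [|[|[|[|[|]]]]].
Qed.

(** Descent: 5 divides x and y, and dividing both by 5 lowers a by one. At a = 0 it would make 5
    divide c. *)
Lemma sqr_3sqr_val5 a c x y :
  ~~ (5 %| c)%N -> (x ^ 2 + 3 * y ^ 2)%N != (5 ^ (2 * a + 1) * c)%N.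
Proof.
move=> c5; apply/negP.
have dvd5 b u v : (u ^ 2 + 3 * v ^ 2)%N = (5 ^ (2 * b + 1) * c)%N ->
    exists u' v', u = (u' * 5)%N /\ v = (v' * 5)%N.
  move=> eq_uv; have : (5 %| u ^ 2 + 3 * v ^ 2)%N.
    by rewrite eq_uv addn1 expnS -mulnA dvdn_mulr.
  by case/dvd5_sqr_3sqr/andP => /dvdnP[u' ->] /dvdnP[v' ->]; exists u', v'.
elim: a x y => [|a IHa] x y /eqP eq_xy; have [u [v [ux vy]]] := dvd5 _ _ _ eq_xy.
  rewrite ux vy in eq_xy; have c_eq : (c = 5 * (u ^ 2 + 3 * v ^ 2))%N by nia.
  by rewrite c_eq dvdn_mulr in c5.
apply: (IHa u v); apply/eqP; move: eq_xy; rewrite ux vy.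
have -> : (2 * a.+1 + 1 = (2 * a + 1).+2)%N by lia.
by rewrite !expnS; nia.
Qed.

(** * Counting representations by x^2 + 3 y^2 modulo 3 *)

Fixpoint int_range (K : nat) : seq int :=
  if K is K'.+1 then K%:Z :: - K%:Z :: int_range K' else [:: 0].

Lemma mem_int_range K z : (z \in int_range K) = (`|z| <= K)%N.
Proof.
elim: K => [|K IHK]; first by rewrite inE; lia.
by rewrite /= !inE IHK; lia.
Qed.

Lemma int_range_uniq K : uniq (int_range K).
Proof. by elim: K => //= K ->; rewrite inE !mem_int_range; lia. Qed.

Lemma phi_int (R : comPzRingType) K (q : R) :
  phi K q = \sum_(z <- int_range K) (-1) ^+ `|z|%N * q ^+ (`|z| ^ 2).
Proof.
rewrite /phi; elim: K => [|K IHK].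
  by rewrite big_geq // big_seq1 mulr0 addr0 !expr0 mulr1.
rewrite big_nat_recr //= !big_cons -IHK abszN absz_nat; ring.
Qed.

Definition sqr_3sqr_sols K n : seq (int * int) :=
  [seq p <- [seq (x, y) | x <- int_range K, y <- int_range K]
         | `|p.1| ^ 2 + 3 * `|p.2| ^ 2 == n]%N.

(** Solutions satisfy |x|, |y| <= n, so the box of radius K contains them all. *)
Lemma mem_sols K n x y : (n <= K)%N ->
  ((x, y) \in sqr_3sqr_sols K n) = (x ^+ 2 + 3 * y ^+ 2 == n%:Z).
Proof.
move=> le_nK.
have sqE (z : int) : z ^+ 2 = (`|z| ^ 2)%N%:Z by rewrite -abszX gez0_abs ?Num.Theory.sqr_ge0.
rewrite mem_filter !sqE /=; apply/andP/idP => [[/eqP <- _]|/eqP n_eq]; first by lia.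
split; first by lia.
by apply/allpairsP; exists (x, y); rewrite !mem_int_range /=; split=> //; nia.
Qed.

Lemma phi_phi3 (R : comPzRingType) K (q : R) :
  phi K q * phi K (q ^+ 3) = \sum_(p <- [seq (x, y) | x <- int_range K, y <- int_range K])
    (-1) ^+ (`|p.1| + `|p.2|)%N * q ^+ (`|p.1| ^ 2 + 3 * `|p.2| ^ 2).
Proof.
rewrite !phi_int mulr_suml big_allpairs; apply: eq_bigr => x _.
rewrite mulr_sumr; apply: eq_bigr => y _.
by rewrite /= -exprM (exprD (-1)) (exprD q (_ ^ 2)) mulrACA.
Qed.

(** For even n, x and y have equal parity, so every sign is +1. *)
Lemma phi_phi3_coef (R : comNzRingType) K n : ~~ odd n ->
  (phi K 'X * phi K 'X^3 : {poly R})`_n = (size (sqr_3sqr_sols K n))%:R.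
Proof.
move=> even_n; rewrite phi_phi3.
rewrite coef_sum -sum1_size natr_sum big_filter [RHS]big_mkcond /=.
apply: eq_bigr => -[x y] _ /=; rewrite -signr_odd mulr_sign.
rewrite (fun_if (fun p : {poly R} => p`_n)) coefN coefXn eq_sym.
case: eqP => [n_eq|_]; last by rewrite oppr0 if_same.
have -> // : odd (`|x| + `|y|) = false.
move: even_n; rewrite -n_eq !(oddD, oddM, oddX) /=.
by case: (odd _); case: (odd _).
Qed.

(** Injectivity of f bounds each class by the next around the cycle, so the three classes
    partitioning s have equal size. *)
Lemma size_3cycle (T : eqType) (s : seq T) (P1 P2 P3 : pred T) (f : T -> T) :
  uniq s -> {in s &, injective f} -> {in s, forall x, f x \in s} ->
  {in s, forall x, P1 x -> P2 (f x)} -> {in s, forall x, P2 x -> P3 (f x)} ->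
  {in s, forall x, P3 x -> P1 (f x)} ->
  {in s, forall x, P1 x + P2 x + P3 x = 1}%N -> (3 %| size s)%N.
Proof.
move=> uniq_s inj_f fs f12 f23 f31 P123.
have le (P Q : pred T) : {in s, forall x, P x -> Q (f x)} -> (count P s <= count Q s)%N.
  move=> PQ; rewrite -!size_filter -(size_map f); apply: uniq_leq_size.
    rewrite map_inj_in_uniq ?filter_uniq // => x y.
    by rewrite !mem_filter => /andP[_ xs] /andP[_ ys]; apply: inj_f.
  by move=> _ /mapP[x + ->]; rewrite !mem_filter => /andP[Px xs]; rewrite fs // PQ.
have -> : size s = (count P1 s + count P2 s + count P3 s)%N.
  elim: s P123 {uniq_s inj_f fs f12 f23 f31 le} => //= x s IHs P123.
  rewrite IHs => [|y ys]; last by apply: P123; rewrite inE ys orbT.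
  by have := P123 x (mem_head _ _); lia.
by have := le _ _ f12; have := le _ _ f23; have := le _ _ f31; lia.
Qed.

Lemma dvd3_size_sols K n : (0 < n <= K)%N -> ~~ odd n -> (3 %| size (sqr_3sqr_sols K n))%N.
Proof.
move=> /andP[n_gt0 le_nK] even_n.
(* With a := (x - y) / 2, b := (- x - y) / 2 and c := y, one has a + b + c = 0 and
   x^2 + 3 y^2 = 2 (a^2 + b^2 + c^2): f is the cyclic shift of (a, b, c), and the
   three predicates say which of a, b, c is the first maximum in cyclic order. *)
pose f (p : int * int) := let a := ((p.1 - p.2) %/ 2)%Z in (- a - 2 * p.2, a).
have halve x y : (x, y) \in sqr_3sqr_sols K n ->
    exists2 a, x = y + 2 * a & f (x, y) = (- a - 2 * y, a).
  rewrite mem_sols // => /eqP n_eq; have [a xy] : exists a, x - y = a * 2.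
    have [[a ->]|[a xy]] : (exists a, x - y = a * 2) \/ (exists a, x - y = a * 2 + 1).
    - have : ((x - y) %% 2)%Z = 0 \/ ((x - y) %% 2)%Z = 1 by lia.
      by rewrite {3 4}(divz_eq (x - y) 2) => -[->|->]; [left|right]; exists ((x - y) %/ 2)%Z;
         rewrite ?addr0.
    - by exists a.
    have x_eq : x = y + 2 * a + 1 by lia.
    have := n_eq; rewrite x_eq.
    have -> : (y + 2 * a + 1) ^+ 2 + 3 * y ^+ 2 =
      2 * (2 * y ^+ 2 + 2 * a ^+ 2 + 2 * a + 2 * a * y + y) + 1 by ring.
    by lia.
  exists a; first by lia.
  by rewrite /f /= xy mulzK.
apply: (@size_3cycle _ _ (fun p => (0 <= p.1) && (3 * p.2 < p.1))
         (fun p => (p.1 <= 3 * p.2) && (- p.1 < 3 * p.2))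
         (fun p => (3 * p.2 <= - p.1) && (p.1 < 0)) f).
- by rewrite filter_uniq // allpairs_uniq ?int_range_uniq // => -[? ?] [? ?].
- move=> [x y] [x' y'] /halve[a -> ->] /halve[a' -> ->] [e1 e2]; congr (_, _); lia.
- move=> [x y] p_s; have [a x_eq ->] := halve _ _ p_s; move: p_s.
  by rewrite !mem_sols // x_eq => /eqP <-; apply/eqP; ring.
1-3: move=> [x y] /halve[a -> ->] /=; lia.
(* The three sectors cover everything but the origin, which n > 0 excludes. *)
move=> [x y]; rewrite mem_sols //= => /eqP n_eq; nia.
Qed.

(** * The generating function of [RD 4 9] modulo 2 and modulo 3 *)

Definition RD_prod (R : pzRingType) M (q : R) : R :=
  \prod_(1 <= k < M.+1 | ~~ (4 %| k)%N) \sum_(j < 9) q ^+ (k * j).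

Lemma RD_prod_coef (F : fieldType) M n : (n <= M)%N ->
  (RD_prod M 'X : {poly F})`_n = (RD 4 9 n)%:R.
Proof.
move=> le_nM; rewrite -(RD_coef F 4 8) /RD_prod (@big_cat_nat _ _ _ n.+1) //=.
set p := \prod_(1 <= k < n.+1 | _) _; transitivity ((p * 1)`_n); last by rewrite mulr1.
apply: (@eqX_coef _ n.+1) => //; apply: eqX_mul => //; apply: eqX_prod1 => k /andP[lt_nk _] _.
rewrite big_ord_recl muln0 expr0; apply: eqXDr.
elim/big_ind: _ => [||j _]; [exact: dvdp0 | exact: dvdp_add | apply: dvdp_exp2l].
by rewrite /= /bump /=; nia.
Qed.

Lemma RD_prod_euler4 (R : comPzRingType) M (q : R) :
  RD_prod M q * euler4 M q = euler4 M (q ^+ 9).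
Proof.
rewrite /RD_prod /euler4 -big_split /=; apply: eq_bigr => k _.
rewrite -exprM mulnC exprM -[RHS]opprB subrX1 -mulNr opprB mulrC.
by congr (_ * _); apply: eq_bigr => j _; rewrite exprM.
Qed.

(** Multiplied by 1 - x, both sides become 1 - x^9, by applying Frobenius twice. *)
Lemma geom9_pchar3 (R : idomainType) (pcharR : 3 \in [pchar R]) (x : R) :
  x != 1 -> \sum_(j < 9) x ^+ j = (1 - x) ^+ 8.
Proof.
rewrite -subr_eq0 -opprB oppr_eq0 => nz; apply: (mulfI nz); rewrite -exprS.
have -> : (1 - x) ^+ 9 = 1 - x ^+ 9.
  rewrite -[9%N]/(3 * 3)%N !exprM -!(pFrobenius_autE pcharR).
  by rewrite !(rmorphB, rmorph1).
by rewrite -[RHS]opprB subrX1 -mulNr opprB.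
Qed.

Lemma RD_prod_pchar3 (F : fieldType) (pcharF : 3 \in [pchar F]) M :
  RD_prod M 'X = euler4 M 'X ^+ 8 :> {poly F}.
Proof.
rewrite /RD_prod /euler4 -prodrXl big_nat_cond [RHS]big_nat_cond.
apply: eq_bigr => k /andP[/andP[k_gt0 _] _].
rewrite -geom9_pchar3 ?pchar_poly //; first by apply: eq_bigr => j _; rewrite exprM.
apply/eqP => /(congr1 (fun p : {poly F} => p`_0)) /eqP.
by rewrite coef1 coefXn (ltn_eqF k_gt0) eq_sym oner_eq0.
Qed.

Lemma psi_dissectX (R : comNzRingType) K :
  psi (3 * K) 'X = 'X^0 * (pent K 'X \Po 'X^3) + 'X^1 * (psi K 'X^3 \Po 'X^3) :> {poly R}.
Proof.
rewrite psi_dissect -(psi_comp R K 3 3) expr0 mul1r; congr (_ + _).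
rewrite /pent raddf_sum /=; apply: eq_bigr => j _.
by rewrite comp_polyD !comp_Xn_poly.
Qed.

Lemma sect_comp (R : comNzRingType) d r m (u : {poly R}) : (r < d)%N -> (m < d)%N ->
  sect d r ('X^m * (u \Po 'X^d)) = (m == r)%:R * u.
Proof. by move=> lt_rd lt_md; rewrite sectM // sect_Xn. Qed.

Lemma dvdp_X_Xn (F : fieldType) k : (0 < k)%N -> ('X : {poly F}) %| 'X^k.
Proof. by case: k => // k _; rewrite exprS dvdp_mulr. Qed.

Lemma coef0_phi (F : fieldType) N (q : {poly F}) : 'X %| q -> (0 < N)%N -> (phi N q)`_0 = 1.
Proof.
move=> Xq N_gt0; have := eqX_coef (phi_eulerX N Xq) N_gt0.
by rewrite expr2 !coef0M !coef0_euler ?dvdp_mulr // !mulr1.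
Qed.

Lemma RD_pchar2 (F : fieldType) (pcharF : 2 \in [pchar F]) m :
  (RD 4 9 (3 * m + 2))%:R = 0 :> F.
Proof.
set N := (3 * m + 2)%N; pose L := (3 * m.+1)%N.
rewrite -(@RD_prod_coef _ L); last by rewrite /N /L; lia.
set P : {poly F} := RD_prod L 'X.
have Xn_dvd := @dvdp_X_Xn F.
(* The product [euler4 L 'X * psi L 'X], congruent to 1, is inserted; [RD_prod_euler4] then leaves
   the same product at ['X^9]. *)
have P_psi : eqX L (P * psi L 'X^9) (psi L 'X).
  apply: (@eqX_trans _ _ _ (P * psi L 'X^9 * (euler4 L 'X * psi L 'X))).
    by rewrite -{1}[P * _]mulr1; apply: eqX_mul => //; apply/eqX_sym/euler4_psi_pchar2.
  have -> : P * psi L 'X^9 * (euler4 L 'X * psi L 'X) =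
    P * euler4 L 'X * psi L 'X^9 * psi L 'X by ring.
  rewrite RD_prod_euler4 -[X in eqX _ _ X]mul1r; apply: eqX_mul => //.
  by apply: euler4_psi_pchar2 => //; apply: Xn_dvd.
have : eqX m.+1 (sect 3 2 P) 0.
  apply: (@eqX_cancel _ _ (psi L 'X^3)); first by rewrite coef0_psi ?oner_neq0 ?Xn_dvd.
  rewrite mulr0 mulrC -sectM // -psi_comp.
  apply: eqX_trans (eqX_sect _ _ P_psi) _; [by [] | by rewrite /L; lia|].
  by rewrite psi_dissectX sectD // !sect_comp // !mul0r addr0.
move=> /(@eqX_coef _ _ _ _ m); rewrite coef_sect // coef0; apply; exact: ltnSn.
Qed.

(** The exponents are (x^2 - 1) / 24 in [pent] and (y^2 - 1) / 8 in [psi], with y = 2k + 1; if they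
    add up to m, then x^2 + 3 y^2 = 24 m + 4. *)
Lemma pent_psi_coef (R : comNzRingType) K L m :
  (forall x y, x ^ 2 + 3 * y ^ 2 != 24 * m + 4)%N ->
  (pent K 'X * psi L 'X : {poly R})`_m = 0.
Proof.
move=> no_rep; rewrite /pent /psi mulr_suml coef_sum big1 // => j _.
rewrite mulr_sumr coef_sum big1 // => k _.
have Tj := bin2S_double j; rewrite binS bin1 in Tj; have Tk := bin2S_double k.
rewrite mulrDl -!exprD coefD !coefXn.
have /negbTE -> : m != (3 * 'C(j, 2) + 2 * j + 'C(k.+1, 2))%N.
  by apply: contra_neq (no_rep (6 * j + 1)%N (2 * k + 1)%N) => m_eq; apply/eqP; nia.
have /negbTE -> : m != (3 * 'C(j, 2) + 4 * j + 1 + 'C(k.+1, 2))%N.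
  by apply: contra_neq (no_rep (6 * j + 5)%N (2 * k + 1)%N) => m_eq; apply/eqP; nia.
by rewrite addr0.
Qed.

Lemma RD_pchar3 (F : fieldType) (pcharF : 3 \in [pchar F]) m :
  (forall x y, x ^ 2 + 3 * y ^ 2 != 24 * m + 4)%N -> (RD 4 9 (6 * m + 2))%:R = 0 :> F.
Proof.
(* The index is reached in two extractions: N = 2 (3m + 1), then residue 1 modulo 3. [L] is a
   multiple of 3 for [psi_dissectX], and L = N + 1. *)
move=> no_rep; set N := (6 * m + 2)%N; pose K := (2 * m + 1)%N; pose L := (3 * K)%N.
rewrite -(@RD_prod_coef _ L); last by rewrite /N /L /K; lia.
rewrite RD_prod_pchar3 //; set P : {poly F} := euler4 L 'X ^+ 8.
have pchar3 : 3 \in [pchar {poly F}] by rewrite pchar_poly.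
have Xn_dvd := @dvdp_X_Xn F.
have P_phi : eqX L (P * (psi L 'X^2 * psi L 'X^6)) (phi L 'X * phi L 'X^3).
  have -> : psi L 'X^6 = psi L 'X^2 ^+ 3 :> {poly F} by rewrite psi_pchar // -exprM.
  have -> : phi L 'X^3 = phi L 'X ^+ 3 :> {poly F} by rewrite phi_pchar.
  rewrite -!exprS /P.
  have -> : euler4 L 'X ^+ 8 * psi L 'X^2 ^+ 4 =
    (euler4 L 'X ^+ 2 * psi L 'X^2) ^+ 4 :> {poly F} by ring.
  by apply: eqX_exp; apply: euler4_psi_phi.
have psi_comp1 d : psi L 'X^d = psi L 'X \Po 'X^d :> {poly F}.
  by rewrite -[d]mul1n psi_comp expr1 mul1n.
pose E := sect 2 0 P; pose M := (3 * m + 2)%N.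
have E_psi : eqX M (E * (psi L 'X * psi L 'X^3)) 1.
  rewrite -sectM // comp_polyM -psi_comp1 -psi_comp.
  apply: eqX_trans (eqX_sect _ _ P_phi) _; [by [] | by rewrite /L /K /M; lia|].
  apply: coef_eqX => i lt_iM; rewrite coef_sect // addn0 coef1.
  (* Index 0 is separate: there the origin is the only solution, and the coefficient is 1. *)
  case: i lt_iM => [|i] lt_iM.
    rewrite coef0M.
    by rewrite !coef0_phi ?mulr1 ?Xn_dvd // /L /K; lia.
  rewrite phi_phi3_coef; last by rewrite mul2n odd_double.
  apply/eqP; rewrite -(dvdn_pcharf pcharF) dvd3_size_sols //.
    by rewrite /L /K /M in lt_iM *; lia.
  by rewrite mul2n odd_double.
have psi3 : psi L 'X^3 = psi L 'X ^+ 3 :> {poly F} by rewrite psi_pchar.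
have {}E_psi : eqX M (E * psi L 'X^3 ^+ 2) (psi L 'X ^+ 2).
  have -> : E * psi L 'X^3 ^+ 2 = E * (psi L 'X * psi L 'X^3) * psi L 'X ^+ 2.
    by rewrite psi3; ring.
  by rewrite -[X in eqX _ _ X]mul1r; apply: eqX_mul.
pose G := sect 3 1 E.
(* The exponents 1 modulo 3 in psi^2 come from the cross term 2 q A(q^3) psi(q^9). Hence G psi^2 = 2
   A psi(q^3) = 2 A psi^3, and psi^2 cancels. *)
have G_psi : eqX m.+1 G (2 * (pent K 'X * psi L 'X)).
  apply: (@eqX_cancel _ _ (psi L 'X ^+ 2)).
    by rewrite expr2 coef0M !coef0_psi ?mulr1 ?oner_neq0 // /L /K; lia.
  rewrite mulrC -sectM // expr2 comp_polyM -psi_comp1 -expr2.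
  apply: eqX_trans (eqX_sect _ _ E_psi) _; [by [] | by rewrite /M; lia|].
  have -> : psi L 'X ^+ 2 = 'X^0 * (pent K 'X ^+ 2 \Po 'X^3) +
      'X^1 * ((pent K 'X * psi K 'X^3 + pent K 'X * psi K 'X^3) \Po 'X^3) +
      'X^2 * (psi K 'X^3 ^+ 2 \Po 'X^3) :> {poly F}.
    rewrite psi_dissectX !expr2 comp_polyD !comp_polyM expr0 expr1.
    by ring.
  rewrite !sectD // !sect_comp // !mul0r add0r addr0 mul1r -mulr2n -[_ *+ 2]mulr_natl.
  have -> : psi L 'X ^+ 2 * (2 * (pent K 'X * psi L 'X)) = 2 * (pent K 'X * psi L 'X^3) :> {poly F}.
    by rewrite psi3; ring.
  apply: eqX_mul => //; apply: eqX_mul => //.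
  apply: (@eqX_trans _ _ _ (psi m.+1 'X^3)); last apply: eqX_sym.
    by apply: psi_trunc; [apply: Xn_dvd | rewrite /K; lia].
  by apply: psi_trunc; [apply: Xn_dvd | rewrite /L /K; lia].
have -> : P`_N = G`_m.
  rewrite !coef_sect //; congr (_`_ _); rewrite /N; lia.
by rewrite (eqX_coef G_psi) // -[2]/(1 + 1) mulrDl !mul1r coefD !pent_psi_coef // addr0.
Qed.

Local Close Scope ring_scope.

Theorem theorem4p1 (alpha n i : nat) (hi : 1 <= i <= 4) :
  RD 4 9 (6 * 5 ^ (2 * alpha + 2) * n + 6 * 5 ^ (2 * alpha + 1) * i
          + 5 ^ (2 * alpha + 2) + 1) = 0 %[mod 6].
Proof.
(* Powers of 25 are 1 modulo 6, so the argument has the form 6m + 2. *)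
have [w w_eq] : exists w, (5 ^ (2 * alpha + 2) = 6 * w + 1)%N.
  elim: alpha => [|a [w w_eq]]; first by exists 4%N.
  have -> : (2 * a.+1 + 2 = (2 * a + 2).+2)%N by lia.
  by exists (25 * w + 4)%N; rewrite !expnS w_eq; lia.
pose m := (5 ^ (2 * alpha + 2) * n + 5 ^ (2 * alpha + 1) * i + w)%N.
have -> : (6 * 5 ^ (2 * alpha + 2) * n + 6 * 5 ^ (2 * alpha + 1) * i
          + 5 ^ (2 * alpha + 2) + 1 = 6 * m + 2)%N by rewrite /m {2}w_eq; nia.
apply/eqP; rewrite mod0n -/(6 %| _)%N (@Gauss_dvd 2 3) //; apply/andP; split.
  have -> : (6 * m + 2 = 3 * (2 * m) + 2)%N by lia.
  have pchar2 := pchar_Fp (isT : prime 2).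
  by rewrite (dvdn_pcharf pchar2); apply/eqP; apply: RD_pchar2.
have pchar3 := pchar_Fp (isT : prime 3).
rewrite (dvdn_pcharf pchar3); apply/eqP; apply: RD_pchar3 => // x y.
(* This is 4 (6m + 1); the cofactor is prime to 5 because 1 <= i <= 4. *)
have -> : (24 * m + 4 = 5 ^ (2 * alpha + 1) * (4 * (30 * n + 6 * i + 5)))%N.
  have e : (5 ^ (2 * alpha + 2) = 5 * 5 ^ (2 * alpha + 1))%N by rewrite -expnS; congr expn; lia.
  by rewrite /m; nia.
by apply: sqr_3sqr_val5; lia.
Qed.
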